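(* Let $\mathbb{V}$ and $\mathbb{W}$ be two finite-dimensional non-zero vector spaces over a field $\mathbb{F}$. If $\mathbb{V}$ and $\mathbb{W}$ are isomorphic as vector spaces, then for any bases $\{\alpha_1,\ldots,\alpha_n\}$ of $\mathbb{V}$ and $\{\beta_1,\ldots,\beta_n\}$ of $\mathbb{W}$, the non-zero component graphs $\Gamma(\mathbb{V}_\alpha)$ and $\Gamma(\mathbb{W}_\beta)$ are isomorphic as graphs.
   Context: For a finite-dimensional vector space $\mathbb{V}$ over $\mathbb{F}$ with basis $\{\alpha_1,\ldots,\alpha_n\}$ and null vector $\theta$, every $\mathbf{a}\in\mathbb{V}$ is written uniquely as $\mathbf{a}=a_1\alpha_1+\cdots+a_n\alpha_n$ with $a_i\in\mathbb{F}$. The non-zero component graph $\Gamma(\mathbb{V}_\alpha)$ with respect to this basis is the simple graph with vertex set $\mathbb{V}\setminus\{\theta\}$ in which two distinct vertices $\mathbf{a},\mathbf{b}$ are adjacent if and only if there is an index $i$ with $a_i\neq 0$ and $b_i\neq 0$. The graph $\Gamma(\mathbb{W}_\beta)$ is defined in the same way from $\mathbb{W}$ and $\{\beta_1,\ldots,\beta_n\}$. The field may be finite or infinite. A graph isomorphism is a bijection of vertex sets that preserves both adjacency and non-adjacency. *)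

(* Defs.v *)
From HB Require Import structures.
From mathcomp Require Import all_boot all_order all_algebra.

Set Implicit Arguments.
Unset Strict Implicit.
Unset Printing Implicit Defensive.

Import GRing.Theory.
Local Open Scope ring_scope.

(* The vertex type may be infinite. *)
Record sgraph := SGraph {
  vertex : eqType;
  adj : rel vertex;
  adj_sym : symmetric adj;
  adj_irrefl : irreflexive adj }.

Definition graph_isomorphic (G H : sgraph) : Prop :=
  exists2 f : vertex G -> vertex H,
    bijective f & {mono f : x y / adj x y}.

Definition vspace_isomorphic (F : fieldType) (V W : vectType F) : Prop :=
  exists f : {linear V -> W}, bijective f.

Section NonzeroComponentGraph.

Variables (F : fieldType) (V : vectType F) (n : nat) (alpha : n.-tuple V).

Definition nonnull := {v : V | v != 0}.

Definition nzc_adj (a b : nonnull) : bool :=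
  (a != b) &&
  [exists i, (coord alpha i (val a) != 0) && (coord alpha i (val b) != 0)].

Fact nzc_adj_sym : symmetric nzc_adj.
Proof.
move=> a b; rewrite /nzc_adj eq_sym; congr (_ && _).
by apply: eq_existsb => i; rewrite andbC.
Qed.

Fact nzc_adj_irrefl : irreflexive nzc_adj.
Proof. by move=> a; rewrite /nzc_adj eqxx. Qed.

(* [coord alpha i a] is the component a_i only when alpha is a basis of V;
   uses of this graph should assume [basis_of fullv alpha]. *)
Definition nzc_graph : sgraph := SGraph nzc_adj_sym nzc_adj_irrefl.

End NonzeroComponentGraph.

(* Main.v *)
(* Sending each vector to the vector with the same coordinates in the other
   basis is a bijection that fixes the null vector, and adjacency depends only
   on which coordinates vanish. *)
Require Import Defs.
From HB Require Import structures.
From mathcomp Require Import all_boot all_order all_algebra.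

Set Implicit Arguments.
Unset Strict Implicit.
Unset Printing Implicit Defensive.

Import GRing.Theory.
Local Open Scope ring_scope.

(** Composing the coordinate map of [alpha] with the expansion along [beta] keeps every coordinate
    ([coord_basis_transfer]), hence the set of indices that decides adjacency. Exchanging the bases
    gives the inverse ([basis_transferK]), and non-null vectors stay non-null
    ([basis_transfer_neq0]). *)

Definition basis_transfer (F : fieldType) (V W : vectType F) (n : nat)
    (alpha : n.-tuple V) (beta : n.-tuple W) (v : V) : W :=
  \sum_(i < n) coord alpha i v *: beta`_i.

Lemma coord_basis_transfer (F : fieldType) (V W : vectType F) (n : nat)
    (alpha : n.-tuple V) (beta : n.-tuple W) (i : 'I_n) (v : V) :
  free beta -> coord beta i (basis_transfer alpha beta v) = coord alpha i v.
Proof. exact: coord_sum_free. Qed.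

(** Freeness of [beta] lets the coordinates of the image be read off; summed along [alpha] they form
    the expansion of [v]. Used in both directions, this gives bijectivity. *)
Lemma basis_transferK (F : fieldType) (V W : vectType F) (n : nat)
    (alpha : n.-tuple V) (beta : n.-tuple W) :
  basis_of {:V} alpha -> free beta ->
  cancel (basis_transfer alpha beta) (basis_transfer beta alpha).
Proof.
move=> Balpha Fbeta v; rewrite [RHS](coord_basis Balpha (memvf v)).
by apply: eq_bigr => i _; rewrite coord_basis_transfer.
Qed.

(** A vector with null image is recovered by transferring 0 back, so it is 0. This lets the transfer
    restrict to vertices. *)
Lemma basis_transfer_neq0 (F : fieldType) (V W : vectType F) (n : nat)
    (alpha : n.-tuple V) (beta : n.-tuple W) (v : V) :
  basis_of {:V} alpha -> free beta -> v != 0 -> basis_transfer alpha beta v != 0.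
Proof.
move=> Balpha Fbeta; apply: contra_neq => v0.
rewrite -(basis_transferK Balpha Fbeta v) v0 /basis_transfer.
by apply: big1 => i _; rewrite linear0 scale0r.
Qed.

Theorem theorem5p1 (F : fieldType) (V W : vectType F)
    (hV : ({:V} != 0)%VS) (hW : ({:W} != 0)%VS)
    (hVW : vspace_isomorphic V W)
    (n : nat) (alpha : n.-tuple V) (beta : n.-tuple W)
    (halpha : basis_of {:V} alpha) (hbeta : basis_of {:W} beta) :
  graph_isomorphic (nzc_graph alpha) (nzc_graph beta).
Proof.
have Fa := basis_free halpha; have Fb := basis_free hbeta.
pose f (a : nonnull V) : nonnull W :=
  Sub (basis_transfer alpha beta (val a))
      (basis_transfer_neq0 halpha Fb (valP a)).
pose g (b : nonnull W) : nonnull V :=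
  Sub (basis_transfer beta alpha (val b))
      (basis_transfer_neq0 hbeta Fa (valP b)).
have fK : cancel f g by move=> a; apply: val_inj; apply: basis_transferK.
have gK : cancel g f by move=> b; apply: val_inj; apply: basis_transferK.
exists f; first by exists g.
(* Injectivity of [f] settles the distinctness conjunct, leaving only the common non-zero index. *)
move=> a b; rewrite /= /nzc_adj (can_eq fK); congr (_ && _).
by apply: eq_existsb => i; rewrite /= !coord_basis_transfer.
Qed.
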